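(* Let $K$ be a post-critically finite self-similar set with boundary $V_0$ and with a resistance form $\mathcal{E}$ coming from a regular self-similar harmonic structure, and fix a non-negative finite Radon measure $\nu$ on $K$. Let $E$ be a compact subset of $K\setminus V_0$. Then there is a constant $C$, depending only on $E$ (with $K$, $\mathcal{E}$ and $\nu$ fixed; in particular not on $u$), such that for every $u\in\operatorname{dom}_{\mathcal{M}}(\Delta)$ satisfying both $u\ge0$ on $K$ and $Lu=\Delta u-u\,\nu=0$ (as an equality of measures), $$\max_E u\le C\min_E u.$$
   Context: **Fractal.** $K$ is the self-similar set of an iterated function system $\{F_1,\dots,F_N\}$ of injective contractions on a complete metric space. For a finite word $\omega=\omega_1\cdots\omega_n$ set $F_\omega=F_{\omega_1}\circ\cdots\circ F_{\omega_n}$ (identity for the empty word); $C_\omega=F_\omega(K)$ is called a cell. $K$ is post-critically finite: $V_0$ (the image in $K$ of the post-critical set) is a finite set, and $C_\omega\cap C_{\omega'}\subset F_\omega(V_0)\cap F_{\omega'}(V_0)$ for distinct words $\omega,\omega'$ of equal length. Put $V_{n+1}=\bigcup_iF_i(V_n)$ and $V_*=\bigcup_nV_n$, which is dense in $K$. **Energy.** There are an irreducible non-negative symmetric quadratic form $\mathcal{E}_0$ on functions on $V_0$, of the form $\mathcal{E}_0(u,u)=\sum_{p\neq q}c_{pq}(u(p)-u(q))^2$ with $c_{pq}\ge0$ and connected graph $\{c_{pq}>0\}$, and factors $0<r_i<1$ such that, with $r_\omega=\prod_jr_{\omega_j}$ and $\mathcal{E}_n(u,u)=\sum_{|\omega|=n}r_\omega^{-1}\mathcal{E}_0(u\circ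 F_\omega,u\circ F_\omega)$, one has $\mathcal{E}_0(u,u)=\min\{\mathcal{E}_1(v,v):v|_{V_0}=u\}$ (regular harmonic structure). Then $\mathcal{E}_n(u,u)$ is non-decreasing in $n$, $\mathcal{E}(u,u)=\lim_n\mathcal{E}_n(u,u)$, and $\operatorname{dom}\mathcal{E}$ consists of the functions with finite limit. $(\mathcal{E},\operatorname{dom}\mathcal{E})$ is a resistance form. The resistance metric $R(p,q)=\sup\{|u(p)-u(q)|^2/\mathcal{E}(u,u):\mathcal{E}(u,u)>0\}$ on $V_*$ has completion homeomorphic to (and identified with) $K$, and functions in $\operatorname{dom}\mathcal{E}$ are continuous on $K$. **Laplacian.** $u\in\operatorname{dom}_{\mathcal{M}}\Delta$ with $\Delta u=\sigma$, $\sigma$ a finite signed Radon measure on $K$, means that $u\in\operatorname{dom}\mathcal{E}$ and $\mathcal{E}(u,v)=-\int_Kv\,d\sigma$ for all $v\in\operatorname{dom}\mathcal{E}$ with $v|_{V_0}=0$. (Only the restriction of $\sigma$ to $K\setminus V_0$ is determined by $u$; statements about $\Delta u$ are understood on $K\setminus V_0$.) The measure $u\,\nu$ has density $u$ with respect to $\nu$; thus $Lu=0$ means $\mathcal{E}(u,v)=-\int_K uv\,d\nu$ for all $v\in\operatorname{dom}\mathcal{E}$ with $v|_{V_0}=0$.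
   Formalization: The compact set E is additionally assumed to lie in a single connected component of K∖V_0; without this the claim is false (e.g. Hata's tree, where a point of V_0 separates K and a non-negative harmonic u can vanish on one branch but not another). *)

(* Defs.v *)
From HB Require Import structures.
From mathcomp Require Export all_boot all_order all_algebra.
From mathcomp Require Export all_classical all_reals all_analysis.

Set Implicit Arguments.
Unset Strict Implicit.
Unset Printing Implicit Defensive.

Import Order.TTheory GRing.Theory Num.Theory.
Import numFieldNormedType.Exports.

Local Open Scope classical_set_scope.
Local Open Scope ring_scope.

#[short(type="completeMetricType")]
HB.structure Definition CompleteMetric (R : numDomainType) :=
  {T of Metric R T & CompletePseudoMetric R T}.

Definition injective_contraction (R : realType) (X : completeMetricType R)
    (f : X -> X) : Prop :=
  injective f /\
  exists2 q : R, 0 <= q < 1 &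
    forall x y : X, mdist (f x) (f y) <= q * mdist x y.

Definition self_similar_set (R : realType) (X : completeMetricType R) (N : nat)
    (F : 'I_N -> X -> X) (K : set X) : Prop :=
  [/\ K !=set0, compact K & K = \bigcup_(i in [set: 'I_N]) (F i @` K)].

Definition Fword (R : realType) (X : completeMetricType R) (N : nat)
    (F : 'I_N -> X -> X) (w : seq 'I_N) : X -> X :=
  foldr (fun i g => F i \o g) id w.

Definition cell (R : realType) (X : completeMetricType R) (N : nat)
    (F : 'I_N -> X -> X) (K : set X) (w : seq 'I_N) : set X :=
  Fword F w @` K.

(* [codes F K s x] says that x is the image of the infinite word s under the
   coding map from the shift space to K, i.e. x is the unique point of
   \bigcap_n F_{s 0 ... s (n-1)}(K). *)
Definition codes (R : realType) (X : completeMetricType R) (N : nat)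
    (F : 'I_N -> X -> X) (K : set X) (s : nat -> 'I_N) (x : X) : Prop :=
  forall n, cell F K (mkseq s n) x.

Definition critical_set (R : realType) (X : completeMetricType R) (N : nat)
    (F : 'I_N -> X -> X) (K : set X) : set (nat -> 'I_N) :=
  [set s | exists x, codes F K s x /\
     exists i j, [/\ i != j, (F i @` K) x & (F j @` K) x]].

Definition post_critical_set (R : realType) (X : completeMetricType R) (N : nat)
    (F : 'I_N -> X -> X) (K : set X) : set (nat -> 'I_N) :=
  [set s | exists n t, [/\ (0 < n)%N, critical_set F K t &
                           s = fun k => t (k + n)%N]].

Definition V0 (R : realType) (X : completeMetricType R) (N : nat)
    (F : 'I_N -> X -> X) (K : set X) : set X :=
  [set x | exists2 s, post_critical_set F K s & codes F K s x].

Definition post_critically_finite (R : realType) (X : completeMetricType R)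
    (N : nat) (F : 'I_N -> X -> X) (K : set X) : Prop :=
  finite_set (V0 F K) /\
  forall w w' : seq 'I_N, size w = size w' -> w <> w' ->
    cell F K w `&` cell F K w' `<=`
      (Fword F w @` V0 F K) `&` (Fword F w' @` V0 F K).

(* Functions on K, on V0 or on V1 are represented by functions on the
    ambient space X of which only the values on that set are used. *)

Definition E0 (R : realType) (X : completeMetricType R) (B : set X)
    (c : X -> X -> R) (u v : X -> R) : R :=
  \sum_(p \in B) \sum_(q \in B `\ p) c p q * ((u p - u q) * (v p - v q)).

Definition En (R : realType) (X : completeMetricType R) (N : nat)
    (F : 'I_N -> X -> X) (K : set X) (c : X -> X -> R) (r : 'I_N -> R)
    (n : nat) (u v : X -> R) : R :=
  \sum_(w : n.-tuple 'I_N)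
    (\prod_(i <- w) r i)^-1 *
      E0 (V0 F K) c (u \o Fword F w) (v \o Fword F w).

Definition connected_graph (R : realType) (X : completeMetricType R)
    (B : set X) (c : X -> X -> R) : Prop :=
  forall p q, B p -> B q ->
    exists s, path (fun a b => `[< B b /\ 0 < c a b >]) p s /\ last p s = q.

Definition regular_harmonic_structure (R : realType)
    (X : completeMetricType R) (N : nat) (F : 'I_N -> X -> X) (K : set X)
    (c : X -> X -> R) (r : 'I_N -> R) : Prop :=
  [/\ forall p q, V0 F K p -> V0 F K q -> 0 <= c p q /\ c p q = c q p,
      connected_graph (V0 F K) c,
      forall i, 0 < r i < 1
    & forall u : X -> R,
        (exists v, (forall p, V0 F K p -> v p = u p) /\
                   En F K c r 1 v v = E0 (V0 F K) c u u) /\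
        (forall v, (forall p, V0 F K p -> v p = u p) ->
                   E0 (V0 F K) c u u <= En F K c r 1 v v)].

(* The values of E_n only see the dense set V_* of K; an element of dom E is
   identified with its continuous extension to K. *)
Definition dom_energy (R : realType) (X : completeMetricType R) (N : nat)
    (F : 'I_N -> X -> X) (K : set X) (c : X -> X -> R) (r : 'I_N -> R) :
    set (X -> R) :=
  [set u | {within K, continuous u} /\ cvgn (fun n => En F K c r n u u)].

Definition energy (R : realType) (X : completeMetricType R) (N : nat)
    (F : 'I_N -> X -> X) (K : set X) (c : X -> X -> R) (r : 'I_N -> R)
    (u v : X -> R) : R :=
  limn (fun n => En F K c r n u v).

(* Kigami's axioms (RF1)-(RF5) for a form E with domain D on the set K. *)
Definition resistance_form (R : realType) (X : completeMetricType R)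
    (K : set X) (D : set (X -> R)) (E : (X -> R) -> (X -> R) -> R) : Prop :=
  [/\ [/\ forall a : R, D (cst a),
          forall (a : R) u v, D u -> D v -> D (fun x => a * u x + v x),
          forall (a : R) u v w, D u -> D v -> D w ->
            E (fun x => a * u x + v x) w = a * E u w + E v w,
          forall u v, D u -> D v -> E u v = E v u
        & forall u, D u -> 0 <= E u u /\
            (E u u = 0 <-> forall x y, K x -> K y -> u x = u y)],
      forall s : nat -> X -> R, (forall n, D (s n)) ->
        (forall e : R, 0 < e -> exists n0, forall m n, (n0 <= m)%N ->
           (n0 <= n)%N -> E (s m \- s n) (s m \- s n) < e) ->
        exists2 u, D u & E (s n \- u) (s n \- u) @[n --> \oo] --> (0 : R),
      forall (V : set X) (v : X -> R), finite_set V -> V `<=` K ->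
        exists2 u, D u & forall x, V x -> u x = v x,
      forall p q, K p -> K q ->
        has_ubound [set (u p - u q) ^+ 2 / E u u |
                     u in [set u | D u /\ 0 < E u u]]
    & forall u, D u ->
        let v := fun x => Num.min (Num.max (u x) 0) 1 in
        D v /\ E v v <= E u u].

(* X with its Borel sigma-algebra.  Every finite Borel measure on the compact
   metric space K is Radon; measures on K are represented by measures on X of
   which only the restriction to K is used. *)
Definition borel (R : realType) (X : completeMetricType R) :=
  g_sigma_algebraType (@open X).

Definition charge_integral (d : measure_display) (T : measurableType d)
    (R : realType) (sigma : {charge set T -> \bar R}) (D : set T)
    (v : T -> R) : R :=
  let P := cid (Hahn_decomposition sigma) in
  let N := cid (svalP P) in
  \int[jordan_pos (svalP N)]_(x in D) v x -
  \int[jordan_neg (svalP N)]_(x in D) v x.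

Definition is_Laplacian (R : realType) (X : completeMetricType R) (N : nat)
    (F : 'I_N -> X -> X) (K : set X) (c : X -> X -> R) (r : 'I_N -> R)
    (u : X -> R) (sigma : {charge set (borel X) -> \bar R}) : Prop :=
  dom_energy F K c r u /\
  forall v, dom_energy F K c r v -> (forall p, V0 F K p -> v p = 0) ->
    energy F K c r u v = - charge_integral sigma K v.

Definition domM_Laplacian (R : realType) (X : completeMetricType R) (N : nat)
    (F : 'I_N -> X -> X) (K : set X) (c : X -> X -> R) (r : 'I_N -> R) :
    set (X -> R) :=
  [set u | exists sigma, is_Laplacian F K c r u sigma].

(* Lu = Delta u - u nu = 0: the weak equation of [is_Laplacian] with sigma the
   measure of density u with respect to nu. *)
Definition L_eq0 (R : realType) (X : completeMetricType R) (N : nat)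
    (F : 'I_N -> X -> X) (K : set X) (c : X -> X -> R) (r : 'I_N -> R)
    (nu : {finite_measure set (borel X) -> \bar R}) (u : X -> R) : Prop :=
  forall v, dom_energy F K c r v -> (forall p, V0 F K p -> v p = 0) ->
    energy F K c r u v = - \int[nu]_(x in K) (u x * v x).

(* Main.v *)
(* A non-negative solution u is tested against v = phi^2 / (u + e), where phi
   is a cutoff equal to 1 on a cell C_w disjoint from V_0 and to 0 on V_0.
   Picone's identity bounds the energy of ln (u + e) on C_w by
   4 (E(phi, phi) + nu(K)), uniformly in u and e.  For a resistance form,
   bounded energy gives bounded oscillation, which is Harnack's inequality on
   C_w.  Every point of K \ V_0 is interior in K to a finite union of such
   cells containing it; connectedness and compactness do the rest. *)
From mathcomp Require Import finmap.
Require Import Defs.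
From mathcomp Require Import ring lra.

Set Implicit Arguments.
Unset Strict Implicit.
Unset Printing Implicit Defensive.

Import Order.TTheory GRing.Theory Num.Theory.
Import numFieldNormedType.Exports.
Local Open Scope classical_set_scope.
Local Open Scope ring_scope.

(** The sets whose complement in [A] satisfies [P] form a filter containing [A]. If [P A] failed,
    this filter would be proper and cluster at a point of [A], which the local hypothesis
    excludes. *)
Lemma compact_local_induction (T : topologicalType) (A : set T)
    (P : set T -> Prop) :
  compact A -> P set0 ->
  (forall B C, P B -> P C -> P (B `|` C)) ->
  (forall B C, B `<=` C -> P C -> P B) ->
  (forall x, A x -> exists2 U, nbhs x U & P (A `&` U)) ->
  P A.
Proof.
move=> cA P0 PU PS Ploc; apply: contrapT => nPA.
pose G : set_system T := [set S | P (A `\` S)].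
have Gfilter : ProperFilter G.
  split; first by rewrite /G /= setD0.
  split => [|S S' GS GS'|S S' SS' GS].
  - by rewrite /G /= setDT.
  - by rewrite /G /= setDIr; exact: PU.
  - by apply: PS GS; exact: setDS.
have GonA : G A by rewrite /G /= setDv.
have [x [Ax clx]] := cA G Gfilter GonA.
have [U Ux PU_] := Ploc x Ax.
have GcO : G (~` U) by rewrite /G /= setDE setCK.
by have [y [? ?]] := clx _ _ GcO Ux.
Qed.

(** The integral of a non-negative function is a supremum over simple functions, and those below [f]
    on [D] are also below [M]. *)
Lemma Rintegral_le_cst d (T : measurableType d) (R : realType)
    (mu : {finite_measure set T -> \bar R}) (D : set T) (f : T -> R) (M : R) :
  measurable D -> 0 <= M -> (forall x, D x -> 0 <= f x <= M) ->
  \int[mu]_(x in D) f x <= M * fine (mu D).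
Proof.
move=> mD M0 fM.
have f0 x : D x -> (0 <= (f x)%:E)%E by move=> /fM /andP[+ _]; rewrite lee_fin.
have muD : mu D \is a fin_num by exact: fin_num_measure.
have intM : (\int[mu]_(x in D) (cst M%:E x) = M%:E * mu D)%E.
  by rewrite integral_cst.
have intfM : (\int[mu]_(x in D) (f x)%:E <= M%:E * mu D)%E.
  rewrite -intM !ge0_integralE//; apply: le_ereal_sup => _ [h /= hf <-].
  exists h => // x; apply: le_trans (hf x) _.
  rewrite /patch; case: ifPn => //; rewrite inE => Dx.
  by rewrite lee_fin; have /andP[] := fM x Dx.
have int0 : (0 <= \int[mu]_(x in D) (f x)%:E)%E by exact: integral_ge0.
rewrite /Rintegral -[M in M * _]/(fine M%:E) -fineM// fine_le//.
- rewrite ge0_fin_numE//; apply: le_lt_trans intfM _.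
  by rewrite ltey_eq fin_numM.
- by rewrite fin_numM.
Qed.

(** * Elementary inequalities for the values at the two ends of an edge *)

Section real_inequalities.
Context (R : realType).
Implicit Types a b s t e : R.

(** By symmetry [b <= a]. With [z = sqrt (a / b) >= 1] the left side is [4 (ln z)^2], where
    [ln z <= z - 1], and the quotient on the right is [(z - 1)^2 (1 + 1/z)^2]. *)
Lemma sqr_ln_sub_le a b : 0 < a -> 0 < b ->
  (ln a - ln b) ^+ 2 <= 4 * ((a - b) ^+ 2 / (a * b)).
Proof.
wlog ab : a b / b <= a.
  move=> H a0 b0; have [/H|/ltW/H] := leP b a; first exact.
  move=> /(_ b0 a0); congr (_ <= _); first by ring.
  by rewrite (mulrC b a); congr (_ * (_ / _)); ring.
move=> a0 b0.
set x := Num.sqrt a; set y := Num.sqrt b.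
have x0 : 0 < x by rewrite sqrtr_gt0.
have y0 : 0 < y by rewrite sqrtr_gt0.
have -> : a = x ^+ 2 by rewrite sqr_sqrtr// ltW.
have -> : b = y ^+ 2 by rewrite sqr_sqrtr// ltW.
have yx : y <= x by rewrite ler_sqrt// ltW.
have z1 : 1 <= x / y by rewrite ler_pdivlMr// mul1r.
have lnE : ln (x ^+ 2) - ln (y ^+ 2) = 2 * ln (x / y).
  by rewrite !lnXn// ln_div ?posrE// -[2 in RHS]/(2%:R) mulr_natl mulrnBl.
rewrite lnE exprMn -[2 ^+ 2 : R]natrX ler_pM2l//.
have lnz0 : 0 <= ln (x / y) by exact: ln_ge0.
have lnz : ln (x / y) <= x / y - 1.
  by have := @le_ln1Dx R (x / y - 1); rewrite (addrC 1) subrK; apply; lra.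
apply: (@le_trans _ _ ((x / y - 1) ^+ 2)).
  by rewrite ler_sqr// nnegrE; lra.
have -> : (x ^+ 2 - y ^+ 2) ^+ 2 / (x ^+ 2 * y ^+ 2) =
    (x / y - 1) ^+ 2 * (1 + y / x) ^+ 2.
  by field; rewrite !gt_eqF.
rewrite ler_peMr ?sqr_ge0// exprn_ege1// lerDl.
by rewrite divr_ge0// ltW.
Qed.

(** Here [s, t] stand for the values of the cutoff and [a, b] for those of [u + e] at the ends of an
    edge. Where [s = t = 1] the right side is the quotient that controls the increment of the
    logarithm in [sqr_ln_sub_le]. *)
Lemma picone_identity a b s t : 0 < a -> 0 < b ->
  (s - t) ^+ 2 - (a - b) * (s ^+ 2 / a - t ^+ 2 / b) =
  (s * b - t * a) ^+ 2 / (a * b).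
Proof. by move=> a0 b0; field; rewrite !gt_eqF. Qed.

(** The difference splits into a change of numerator, where [s + t <= 2], and a change of
    denominator. Summed over edges, this bounds the energy of [phi^2 / (u + e)]. *)
Lemma sqr_div_lipschitz e a b s t : 0 < e -> e <= a -> e <= b ->
  0 <= s <= 1 -> 0 <= t <= 1 ->
  (s ^+ 2 / a - t ^+ 2 / b) ^+ 2 <=
  8 / e ^+ 2 * (s - t) ^+ 2 + 2 / e ^+ 4 * (a - b) ^+ 2.
Proof.
move=> e0 ea eb /andP[s0 s1] /andP[t0 t1].
have a0 : 0 < a by lra.
have b0 : 0 < b by lra.
have [e_ge0 a_ge0 b_ge0] : [/\ 0 <= e, 0 <= a & 0 <= b] by split; exact: ltW.
have -> : s ^+ 2 / a - t ^+ 2 / b =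
   (s + t) * (s - t) / a + t ^+ 2 * (b - a) / (a * b).
  by field; rewrite !gt_eqF.
set x := (_ / a); set y := (_ / (a * b)).
have xy : (x + y) ^+ 2 <= 2 * x ^+ 2 + 2 * y ^+ 2.
  by rewrite -subr_ge0; have := sqr_ge0 (x - y); nra.
apply: le_trans xy _; apply: lerD.
  have -> : 8 / e ^+ 2 * (s - t) ^+ 2 = 2 * (4 * (s - t) ^+ 2 / e ^+ 2).
    by field; rewrite gt_eqF.
  rewrite ler_pM2l// /x expr_div_n exprMn ler_pM ?invr_ge0 ?sqr_ge0//.
  - by rewrite mulr_ge0 ?sqr_ge0.
  - rewrite ler_wpM2r ?sqr_ge0//; have -> : 4 = 2 ^+ 2 :> R by rewrite -natrX.
    by rewrite ler_sqr ?nnegrE; lra.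
  - by rewrite lef_pV2 ?posrE ?exprn_gt0// ler_sqr.
have -> : 2 / e ^+ 4 * (a - b) ^+ 2 = 2 * (1 * (b - a) ^+ 2 / (e * e) ^+ 2).
  by field; rewrite gt_eqF.
rewrite ler_pM2l// /y expr_div_n exprMn ler_pM ?invr_ge0 ?sqr_ge0//.
- by rewrite mulr_ge0 ?sqr_ge0.
- by rewrite ler_wpM2r ?sqr_ge0// -exprM exprn_ile1.
- rewrite lef_pV2 ?posrE ?exprn_gt0 ?mulr_gt0//.
  by rewrite ler_sqr ?nnegrE ?mulr_ge0// ler_pM.
Qed.

End real_inequalities.

(** * Words and cells *)

Section words.
Context (R : realType) (X : completeMetricType R) (N : nat)
  (F : 'I_N -> X -> X) (K : set X).

Context (hK : self_similar_set F K).

Lemma self_similar_map (i : 'I_N) (x : X) : K x -> K (F i x).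
Proof. by case: hK => _ _ KE Kx; rewrite KE; exists i => //; exists x. Qed.

Lemma Fword_map (w : seq 'I_N) (x : X) : K x -> K (Fword F w x).
Proof. by move=> Kx; elim: w => //= i w; exact: self_similar_map. Qed.

Lemma cover_cells (n : nat) (x : X) :
  K x -> exists2 w : n.-tuple 'I_N, cell F K w x & True.
Proof.
elim: n x => [|n IH] x Kx; first by exists [tuple] => //; exists x.
case: (hK) => _ _ KE; move: (Kx); rewrite {1}KE => -[i _ [y Ky <-]].
have [w [z Kz zy] _] := IH y Ky.
by exists [tuple of i :: w] => //; exists z => //=; rewrite zy.
Qed.

Lemma V0_sub : V0 F K `<=` K.
Proof. by move=> x [s _ /(_ 0%N)] [y Ky <-]. Qed.

End words.

(** * Weighted sums over the edges of all cells of a given level *)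

Section edge_sums.
Context (R : realType) (X : completeMetricType R) (N : nat)
  (F : 'I_N -> X -> X) (B : set X) (c : X -> X -> R) (r : 'I_N -> R).
Implicit Types (f g : X -> X -> R) (n : nat).

(** This is [E0] with the product of increments replaced by an arbitrary function of the edge, so
    that edgewise relations such as Picone's identity can be summed with the weights of the
    energy. *)
Definition edge_sum f : R :=
  \sum_(p \in B) \sum_(q \in B `\ p) c p q * f p q.

Definition word_sum n f : R :=
  \sum_(w : n.-tuple 'I_N) (\prod_(i <- w) r i)^-1 *
    edge_sum (fun p q => f (Fword F w p) (Fword F w q)).

(** Self-similarity: a word of length [n.+1] is a first letter followed by a word of length [n], and
    the ratios multiply. *)
Lemma word_sumS n f :
  word_sum n.+1 f = \sum_i (r i)^-1 * word_sum n (fun p q => f (F i p) (F i q)).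
Proof.
under [RHS]eq_bigr do rewrite mulr_sumr.
rewrite pair_big /= /word_sum.
rewrite (reindex (fun iw : 'I_N * n.-tuple 'I_N => [tuple of iw.1 :: iw.2])).
  by apply: eq_bigr => -[i w] _ /=; rewrite big_cons invfM mulrA.
exists (fun w : n.+1.-tuple 'I_N => (thead w, [tuple of behead w])) =>
  [[i w]|w] _.
  by congr (_, _); apply: val_inj.
by rewrite /= [RHS]tuple_eta.
Qed.

Context (finB : finite_set B).

Lemma edge_sumE f : edge_sum f =
  \sum_(p <- fset_set B) \sum_(q <- fset_set (B `\ p)) c p q * f p q.
Proof.
rewrite /edge_sum fsbig_finite//; apply: eq_bigr => p _.
by rewrite fsbig_finite//; exact: finite_setD.
Qed.

Lemma edge_sumD f g :
  edge_sum (fun p q => f p q + g p q) = edge_sum f + edge_sum g.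
Proof.
rewrite !edge_sumE -big_split; apply: eq_bigr => p _ /=.
by rewrite -big_split; apply: eq_bigr => q _; rewrite mulrDr.
Qed.

Lemma edge_sumZ (a : R) f : edge_sum (fun p q => a * f p q) = a * edge_sum f.
Proof.
rewrite !edge_sumE mulr_sumr; apply: eq_bigr => p _.
by rewrite mulr_sumr; apply: eq_bigr => q _; rewrite mulrCA.
Qed.

Lemma word_sumD n f g :
  word_sum n (fun p q => f p q + g p q) = word_sum n f + word_sum n g.
Proof.
rewrite -big_split; apply: eq_bigr => w _ /=.
by rewrite edge_sumD mulrDr.
Qed.

Lemma word_sumZ n (a : R) f :
  word_sum n (fun p q => a * f p q) = a * word_sum n f.
Proof.
rewrite mulr_sumr; apply: eq_bigr => w _ /=.
by rewrite edge_sumZ mulrCA.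
Qed.

Context (c_ge0 : forall p q, B p -> B q -> 0 <= c p q)
  (r_gt0 : forall i, 0 < r i).

Lemma prod_ratio_gt0 (w : seq 'I_N) : 0 < \prod_(i <- w) r i.
Proof. by apply: prodr_gt0 => i _. Qed.

Lemma edge_sum_le f g :
  (forall p q, B p -> B q -> f p q <= g p q) -> edge_sum f <= edge_sum g.
Proof.
move=> fg; rewrite !edge_sumE big_seq [leRHS]big_seq; apply: ler_sum => p.
rewrite in_fset_set// inE => Bp.
rewrite big_seq [leRHS]big_seq; apply: ler_sum => q.
rewrite in_fset_set; last exact: finite_setD.
by rewrite inE => -[Bq _]; rewrite ler_wpM2l ?c_ge0 ?fg.
Qed.

Context (A : set X) (BA : B `<=` A) (FA : forall i x, A x -> A (F i x)).

(** All vertices [Fword F w p] stay in the invariant set [A], so the inequality is only asked there.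
    In the application [A] is [K], where [u] is non-negative. *)
Lemma word_sum_le n f g :
  (forall x y, A x -> A y -> f x y <= g x y) -> word_sum n f <= word_sum n g.
Proof.
move=> fg; apply: ler_sum => w _.
have FwA x : B x -> A (Fword F w x).
  by move=> /BA Ax; elim: (val w) => //= i w' /FA.
rewrite ler_wpM2l ?invr_ge0 ?(ltW (prod_ratio_gt0 _))//.
by apply: edge_sum_le => p q /FwA Ap /FwA Aq; exact: fg.
Qed.

Lemma word_sum_ge0 n f :
  (forall x y, A x -> A y -> 0 <= f x y) -> 0 <= word_sum n f.
Proof.
move=> f0; have <- : word_sum n (fun _ _ => 0 * 0) = 0.
  by rewrite (word_sumZ n 0 (fun _ _ => 0)) mul0r.
by apply: word_sum_le => x y Ax Ay; rewrite mul0r f0.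
Qed.

Lemma word_sum_letter n (i : 'I_N) f :
  (forall x y, A x -> A y -> 0 <= f x y) ->
  word_sum n (fun x y => f (F i x) (F i y)) <= r i * word_sum n.+1 f.
Proof.
move=> f0; rewrite mulrC -ler_pdivrMr// mulrC word_sumS (bigD1 i)//= lerDl.
apply: sumr_ge0 => j _; rewrite mulr_ge0 ?invr_ge0 ?(ltW (r_gt0 _))//.
by apply: word_sum_ge0 => x y /FA ? /FA ?; exact: f0.
Qed.

(** On the right, the words beginning with [w] contribute exactly the left side, and the others are
    non-negative. This localises energy bounds to a cell. *)
Lemma word_sum_word n (w : seq 'I_N) f :
  (forall x y, A x -> A y -> 0 <= f x y) ->
  word_sum n (fun x y => f (Fword F w x) (Fword F w y)) <=
  (\prod_(i <- w) r i) * word_sum (size w + n) f.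
Proof.
elim: w f => [|i w IH] f f0; first by rewrite big_nil mul1r.
rewrite /= big_cons.
have := IH (fun x y => f (F i x) (F i y)).
move=> /(_ _)/le_trans; apply; first by move=> x y /FA ? /FA ?; exact: f0.
rewrite -mulrA mulrCA ler_pM2l ?prod_ratio_gt0//.
exact: word_sum_letter.
Qed.

End edge_sums.

Lemma finite_ratio_sup (R : realType) (N : nat) (f : 'I_N -> R) :
  (forall i, 0 <= f i < 1) -> exists2 q, 0 <= q < 1 & forall i, f i <= q.
Proof.
(* Starting the maximum at [0] also covers an empty alphabet. *)
move=> f01; exists (\big[Num.max/0]_i f i); last by move=> i; exact: le_bigmax.
apply/andP; split; last by apply: bigmax_lt => // i _; have /andP[] := f01 i.
by apply: bigmax_ge_id.
Qed.

(** * Contractions and shrinking cells *)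

Section contractions.
Context (R : realType) (X : completeMetricType R) (N : nat)
  (F : 'I_N -> X -> X) (K : set X)
  (hF : forall i, injective_contraction (F i)) (hK : self_similar_set F K).

Lemma nbhs_mdist_lt (x : X) (e : R) : 0 < e -> nbhs x [set y | mdist x y < e].
Proof. by move=> e0; rewrite -ballEmdist; exact: nbhsx_ballx. Qed.

Lemma contraction_continuous (i : 'I_N) : continuous (F i).
Proof.
have [_ [q /andP[q0 q1] Fq]] := hF i.
move=> x; apply/cvg_ballP => e e0.
near=> y.
have xy : mdist x y < e by near: y; exact: nbhs_mdist_lt.
rewrite ballEmdist /=; apply: le_lt_trans (Fq x y) _.
by apply: le_lt_trans xy; rewrite ler_piMl ?mdist_ge0// ltW.
Unshelve. all: by end_near. Qed.

Lemma within_continuous_contraction (i : 'I_N) (u : X -> R) :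
  {within K, continuous u} -> {within K, continuous (u \o F i)}.
Proof.
move=> /subspace_continuousP cu; apply/subspace_continuousP => x Kx.
move=> V /= /(cu _ (self_similar_map hK i Kx)); rewrite !nbhs_simpl /= => VF.
have := contraction_continuous VF; rewrite nbhs_simpl /=.
apply: filterS => y; rewrite /from_subspace /= => yU Ky.
exact: (yU (self_similar_map hK i Ky)).
Qed.

Lemma compact_mdist_bounded : exists2 D : R, 0 < D &
  forall x y, K x -> K y -> mdist x y < D.
Proof.
have [[x0 Kx0] cK _] := hK.
suff [D DK] : exists D : R, forall y, K y -> mdist x0 y < D.
  exists (D + D) => [|x y Kx Ky].
    by have := DK _ Kx0; rewrite mdistxx => ?; exact: addr_gt0.
  apply: le_lt_trans (metric_triangle _ x0 _) _.
  by rewrite (metric_sym x); apply: ltrD; exact: DK.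
apply: (compact_local_induction (P := fun S => exists D : R, forall y, S y ->
  mdist x0 y < D)) => //; first by exists 0.
- move=> S S' [D DS] [D' DS']; exists (Num.max D D') => y.
  by rewrite lt_max => -[/DS ->//|/DS' ->]; rewrite orbT.
- by move=> S S' SS' [D DS']; exists D => y /SS' /DS'.
- move=> x Kx; exists [set y | mdist x y < 1]; first exact: nbhs_mdist_lt.
  exists (mdist x0 x + 1) => y [_ xy].
  by apply: le_lt_trans (metric_triangle _ x _) _; rewrite ltrD2l.
Qed.

(** If [q < 1] bounds all contraction ratios and [D] the distances in [K], distances in a cell of
    level [n] are at most [q ^+ n * D]. *)
Lemma cells_small (e : R) : 0 < e -> exists n : nat, forall w : seq 'I_N,
  size w = n -> forall x y, cell F K w x -> cell F K w y -> mdist x y < e.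
Proof.
move=> e0.
have [D D0 DK] := compact_mdist_bounded.
have ratio i : exists q : R, 0 <= q < 1 /\
    forall x y : X, mdist (F i x) (F i y) <= q * mdist x y.
  by have [_ [q q01 qF]] := hF i; exists q.
have [q_ q_F] := choice ratio.
have [q /andP[q0 q1] q_q] := finite_ratio_sup (fun i => (q_F i).1).
have wF (w : seq 'I_N) x y :
    mdist (Fword F w x) (Fword F w y) <= q ^+ size w * mdist x y.
  elim: w => [|i w IH] /=; first by rewrite expr0 mul1r.
  apply: le_trans ((q_F i).2 _ _) _; rewrite exprS -mulrA.
  apply: ler_pM (q_q i) IH; last exact: mdist_ge0.
  by have /andP[] := (q_F i).1.
have : (fun n => q ^+ n) @ \oo --> (0 : R).
  by apply: cvg_expr; rewrite ger0_norm.
move=> /cvgr0Pnorm_lt /(_ (e / D)) /(_ (divr_gt0 e0 D0)) [n _ /(_ n (leqnn n))].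
rewrite ger0_norm ?exprn_ge0// => qn.
exists n => w wn _ _ [x Kx <-] [y Ky <-].
apply: le_lt_trans (wF _ _ _) _; rewrite wn.
apply: (@le_lt_trans _ _ (q ^+ n * D)); last by rewrite -ltr_pdivlMr.
by rewrite ler_wpM2l ?exprn_ge0// ltW// DK.
Qed.

Lemma cell_compact (w : seq 'I_N) : compact (cell F K w).
Proof.
have [_ cK _] := hK.
elim: w => [|i w IH]; first by rewrite /cell /= image_id.
rewrite /cell /= -image_comp -/(cell F K w).
apply: continuous_compact IH; apply: continuous_subspaceT.
exact: contraction_continuous.
Qed.

Lemma cell_closed (w : seq 'I_N) : closed (cell F K w).
Proof. exact: (compact_closed (@metric_hausdorff _ X) (@cell_compact w)). Qed.

End contractions.

(** * The energy as a monotone limit, and oscillation bounds *)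

Section energy_theory.
Context (R : realType) (X : completeMetricType R) (N : nat)
  (F : 'I_N -> X -> X) (K : set X) (c : X -> X -> R) (r : 'I_N -> R)
  (hF : forall i, injective_contraction (F i)) (hK : self_similar_set F K)
  (finV0 : finite_set (V0 F K)) (hcr : regular_harmonic_structure F K c r)
  (hE : resistance_form K (dom_energy F K c r) (energy F K c r)).
Local Notation En := (En F K c r).
Local Notation dom := (dom_energy F K c r).
Local Notation energy := (energy F K c r).
Local Notation W := (word_sum F (V0 F K) c r).
Implicit Types (u v g : X -> R) (n : nat).

Lemma EnE n u v : En n u v = W n (fun x y => (u x - u y) * (v x - v y)).
Proof. by []. Qed.

Lemma weight_ge0 p q : V0 F K p -> V0 F K q -> 0 <= c p q.
Proof. by case: hcr => h _ _ _ /h /[apply] -[]. Qed.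

Lemma ratio_gt0 i : 0 < r i.
Proof. by case: hcr => _ _ /(_ i) /andP[]. Qed.

Lemma W_le n (f g : X -> X -> R) :
  (forall x y, K x -> K y -> f x y <= g x y) -> W n f <= W n g.
Proof.
exact: (word_sum_le finV0 weight_ge0 ratio_gt0 (V0_sub (K := K))
  (self_similar_map hK)).
Qed.

Lemma W_word n (w : seq 'I_N) (f : X -> X -> R) :
  (forall x y, K x -> K y -> 0 <= f x y) ->
  W n (fun x y => f (Fword F w x) (Fword F w y)) <=
  (\prod_(i <- w) r i) * W (size w + n)%N f.
Proof.
exact: (word_sum_word finV0 weight_ge0 ratio_gt0 (V0_sub (K := K))
  (self_similar_map hK)).
Qed.

Lemma En_ge0 n u : 0 <= En n u u.
Proof.
rewrite EnE; apply: (word_sum_ge0 finV0 weight_ge0 ratio_gt0 (V0_sub (K := K))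
  (self_similar_map hK)) => x y _ _; exact: sqr_ge0.
Qed.

(** The step from level 0 to level 1 is the minimality in the harmonic structure, with [u] as its
    own competitor; self-similarity carries it to every level. *)
Lemma En_nondecreasing u : nondecreasing_seq (fun n => En n u u).
Proof.
apply/nondecreasing_seqP => n; elim: n u => [|n IH] u.
  have [_ _ _ /(_ u) [_ /(_ u)]] := hcr.
  move=> /(_ (fun _ _ => erefl)); apply: le_trans.
  rewrite /Defs.En /= (big_pred1 [tuple]) => [|w]; last first.
    by apply/esym/eqP; exact: tuple0.
  by rewrite big_nil invr1 mul1r.
rewrite !EnE !word_sumS; apply: ler_sum => i _.
by rewrite ler_pM2l ?invr_gt0 ?ratio_gt0//; exact: (IH (u \o F i)).
Qed.

Lemma dom_continuous u : dom u -> {within K, continuous u}.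
Proof. by case. Qed.

Lemma En_cvg u : dom u -> En n u u @[n --> \oo] --> energy u u.
Proof. by case. Qed.

Lemma En_le_energy n u : dom u -> En n u u <= energy u u.
Proof.
move=> [_ cu]; exact: (nondecreasing_cvgn_le (@En_nondecreasing u) cu).
Qed.

Lemma energy_ge0 u : dom u -> 0 <= energy u u.
Proof. by move=> du; apply: le_trans (En_le_energy 0 du); exact: En_ge0. Qed.

(** By monotonicity a uniform bound forces convergence. This is the membership test used for
    composites, quotients and logarithms below. *)
Lemma dom_bounded (M : R) u : {within K, continuous u} ->
  (forall n, En n u u <= M) -> dom u /\ energy u u <= M.
Proof.
move=> cu uM.
have cE : cvgn (fun n => En n u u).
  apply: nondecreasing_is_cvgn; first exact: En_nondecreasing.
  by exists M => _ [n _ <-].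
split; first by split.
by apply: limr_le => //; near=> n; exact: uM.
Unshelve. all: by end_near. Qed.

Lemma dom_comp i u : dom u ->
  dom (u \o F i) /\ energy (u \o F i) (u \o F i) <= r i * energy u u.
Proof.
move=> du; apply: dom_bounded.
  by apply: within_continuous_contraction => //; exact: dom_continuous.
move=> n; apply: le_trans (_ : r i * En n.+1 u u <= _); last first.
  by rewrite ler_pM2l ?ratio_gt0//; exact: En_le_energy.
have := @W_word n [:: i] (fun x y => (u x - u y) * (u x - u y)).
by rewrite big_seq1; apply=> x y _ _; exact: sqr_ge0.
Qed.

Lemma domD u v : dom u -> dom v -> dom (fun x => u x + v x).
Proof.
have [[_ lin _ _ _] _ _ _ _] := hE => du dv.
by have := lin 1 _ _ du dv; congr dom; apply/funext => x; rewrite mul1r.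
Qed.

(** Membership in the domain gives convergence on the diagonal only; polarisation with [u + v]
    yields the mixed terms. *)
Lemma En_cvg2 u v : dom u -> dom v ->
  En n u v @[n --> \oo] --> energy u v.
Proof.
move=> du dv; suff : cvgn (fun n => En n u v) by [].
pose uv x := u x + v x.
have polar n : En n uv uv = En n u u + En n v v + 2 * En n u v.
  rewrite !EnE -(word_sumZ F c r finV0 n 2) -!(word_sumD F c r finV0).
  by congr word_sum; apply/funext => x; apply/funext => y; rewrite /uv; ring.
have EnP n : En n u v = 2^-1 * (En n uv uv - En n u u - En n v v).
  by rewrite polar; field.
rewrite (funext EnP).
exact: cvgP (cvgM (cvg_cst _)
  (cvgB (cvgB (En_cvg (domD du dv)) (En_cvg du)) (En_cvg dv))).
Qed.

(** Axiom (RF4) bounds the quotient when the energy is positive, and functions of zero energy are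
    constant on [K]. The absolute value makes the bound non-negative. *)
Lemma resistance_bound p q : K p -> K q ->
  exists M : R, 0 <= M /\
    forall g, dom g -> (g p - g q) ^+ 2 <= M * energy g g.
Proof.
move=> Kp Kq; have [[_ _ _ _ RF1] _ _ /(_ p q Kp Kq) [M MP] _] := hE.
exists `|M|; split => // g dg; have [g0 gcst] := RF1 g dg.
move: g0; rewrite le_eqVlt => /predU1P[g0|g0].
  by rewrite (gcst.1 (esym g0) p q Kp Kq) subrr expr0n mulr_ge0// energy_ge0.
rewrite -ler_pdivrMr//; apply: le_trans (ler_norm M).
by apply: MP; exists g.
Qed.

(* The increments of g along p, F_{w1} p, F_{w1 w2} p, ... are bounded by a
   geometric series, as the energy of g o F_w is at most r_w times that of g. *)
Lemma resistance_bounded : exists2 D : R, 0 <= D &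
  forall g, dom g -> forall x y, K x -> K y ->
    g x <= g y + D * Num.sqrt (energy g g).
Proof.
have [[p Kp] _ _] := hK.
have [M_ M_P] :=
  choice (fun i => resistance_bound Kp (self_similar_map hK i Kp)).
pose M := Num.sqrt (\sum_i M_ i).
have step i g : dom g -> `|g p - g (F i p)| <= M * Num.sqrt (energy g g).
  move=> dg; rewrite -sqrtr_sqr -sqrtrM; last first.
    by apply: sumr_ge0 => j _; exact: (M_P j).1.
  rewrite ler_wsqrtr//; apply: le_trans ((M_P i).2 _ dg) _.
  rewrite ler_wpM2r ?energy_ge0// (bigD1 i)//= lerDl sumr_ge0// => j _.
  exact: (M_P j).1.
have r01 i : 0 <= Num.sqrt (r i) < 1.
  rewrite sqrtr_ge0 /= -sqrtr1 ltr_sqrt//.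
  by case: hcr => _ _ /(_ i) /andP[].
have [q /andP[q0 q1] rq] := finite_ratio_sup r01.
have q1' : 0 < 1 - q by rewrite subr_gt0.
(* [S] solves [S = M + q * S]: the first step costs [M], and the rest is a chain for [g \o F i],
   whose root energy is smaller by the factor [q]. *)
pose S := M / (1 - q).
have S0 : 0 <= S by rewrite divr_ge0 ?sqrtr_ge0// ltW.
have chain w g : dom g -> `|g p - g (Fword F w p)| <= S * Num.sqrt (energy g g).
  elim: w g => [|i w IH] g dg /=.
    by rewrite subrr normr0 mulr_ge0 ?sqrtr_ge0.
  apply: le_trans (ler_distD (g (F i p)) _ _) _.
  have [dgi Egi] := dom_comp i dg.
  have -> : S * Num.sqrt (energy g g) = M * Num.sqrt (energy g g) +
      S * (q * Num.sqrt (energy g g)).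
    by rewrite /S; field; rewrite gt_eqF.
  apply: lerD (step i g dg) _; apply: le_trans (IH _ dgi) _.
  rewrite ler_wpM2l//; apply: le_trans (_ : Num.sqrt (r i * energy g g) <= _).
    exact: ler_wsqrtr.
  by rewrite sqrtrM ?(ltW (ratio_gt0 i))// ler_wpM2r ?sqrtr_ge0.
(* Every [x] in [K] lies in arbitrarily small cells, each containing a point [Fword F w p];
   continuity extends the bound from these points to [x]. *)
have chainK g x : dom g -> K x -> `|g p - g x| <= S * Num.sqrt (energy g g).
  move=> dg Kx; apply/ler_addgt0Pl => e e0.
  have /subspace_continuousP /(_ x Kx) /cvgrPdist_lt /(_ e e0) :=
    dom_continuous dg.
  rewrite -nbhs_ballE => -[d /= d0 xd].
  have [n small] := cells_small hF hK d0.
  have [w wx _] := cover_cells hK n Kx.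
  have wp : cell F K w (Fword F w p) by exists p.
  have := xd (Fword F w p).
  rewrite ballEmdist /= => /(_ (small w (size_tuple w) _ _ wx wp)).
  move=> /(_ (Fword_map hK w Kp)) xw.
  apply: le_trans (ler_distD (g (Fword F w p)) _ _) _.
  by rewrite addrC; apply: lerD (chain w g dg); rewrite distrC ltW.
exists (S + S); first exact: addr_ge0.
move=> g dg x y Kx Ky; rewrite mulrDl -lerBlDl.
have := ler_distD (g p) (g x) (g y).
move=> /(le_trans (ler_norm _)) /le_trans; apply.
by rewrite distrC; apply: lerD; exact: chainK.
Qed.

End energy_theory.

(** * Harnack's inequality on a cell away from the boundary *)

Section harnack.
Context (R : realType) (X : completeMetricType R) (N : nat)
  (F : 'I_N -> X -> X) (K : set X) (c : X -> X -> R) (r : 'I_N -> R)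
  (nu : {finite_measure set (borel X) -> \bar R})
  (hF : forall i, injective_contraction (F i)) (hK : self_similar_set F K)
  (finV0 : finite_set (V0 F K)) (hcr : regular_harmonic_structure F K c r)
  (hE : resistance_form K (dom_energy F K c r) (energy F K c r)).
Local Notation En := (En F K c r).
Local Notation dom := (dom_energy F K c r).
Local Notation energy := (energy F K c r).
Local Notation W := (word_sum F (V0 F K) c r).
Implicit Types (u v g : X -> R) (n : nat).

Lemma cutoff (A : set X) : compact A -> A `<=` K `\` V0 F K ->
  exists phi : X -> R, [/\ dom phi, forall p, V0 F K p -> phi p = 0,
    forall x, 0 <= phi x <= 1 & forall x, A x -> phi x = 1].
Proof.
move=> cA AK.
have [_ _ RF3 _ RF5] := hE.
(* Lower bounds by 1 survive addition, which handles unions; truncation to [[0, 1]] by (RF5) comes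
   last. *)
suff [psi [dpsi psi0 psi_ge0 psi1]] : exists psi : X -> R,
    [/\ dom psi, forall p, V0 F K p -> psi p = 0,
    forall x, 0 <= psi x & forall x, A x -> 1 <= psi x].
  exists (fun x => Num.min (Num.max (psi x) 0) 1).
  have [dphi _] := RF5 _ dpsi.
  split=> // [p /psi0 ->|x|x Ax].
  - by rewrite maxxx min_l.
  - by rewrite le_min le_max lexx orbT ler01 ge_min lexx orbT.
  - by rewrite min_r// le_max psi1.
apply: (compact_local_induction (P := fun S => exists psi : X -> R,
    [/\ dom psi, forall p, V0 F K p -> psi p = 0,
    forall x, 0 <= psi x & forall x, S x -> 1 <= psi x])) => //.
- exists (cst 0); split=> //.
  by have [[+ _ _ _ _] _ _ _ _] := hE; apply.
- move=> S S' [f [df f0 fge0 fS]] [f' [df' f'0 f'ge0 f'S]].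
  exists (fun x => f x + f' x); split=> [|p Vp|x|x [/fS|/f'S] fx].
  - exact: (domD hE).
  - by rewrite f0// f'0// addr0.
  - exact: addr_ge0.
  - by apply: le_trans fx _; rewrite lerDl.
  - by apply: le_trans fx _; rewrite lerDr.
- move=> S S' SS' [f [df f0 fge0 fS]]; exists f; split=> // x /SS'.
  exact: fS.
move=> x Ax; have [Kx nVx] := AK x Ax.
pose V := V0 F K `|` [set x].
have VK : V `<=` K by move=> y [/V0_sub//|->].
have finV : finite_set V by rewrite finite_setU.
(* The value 2 at [x] leaves room for [f] to exceed 1 on a neighbourhood of [x] in [K]. *)
have [f df fV] := RF3 V (fun y => if y == x then 2 else 0) finV VK.
pose h y := Num.min (Num.max (f y) 0) 1.
have [dh _] := RF5 _ df.
exists [set y | K y -> 1 < f y].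
  have fx : 1 < f x by rewrite fV ?eqxx ?ltr1n//; right.
  have /subspace_continuousP /(_ x Kx) := dom_continuous df.
  by move=> /cvgr_gt /(_ _ fx).
exists h; split=> // [p Vp|y|y [Ay /(_ (AK y Ay).1) fy]].
- have px : p != x by apply/eqP => px; apply: nVx; rewrite -px.
  by rewrite /h fV ?(negbTE px)//; [rewrite maxxx min_l | left].
- by rewrite /h le_min le_max lexx orbT ler01.
- by rewrite /h min_r// le_max (ltW fy).
Qed.

Lemma dom_comp_word (w : seq 'I_N) u : dom u -> dom (u \o Fword F w).
Proof.
elim: w u => [//|i w IH] u du /=.
by rewrite compA; apply: IH; have [] := dom_comp hF hK finV0 hcr i du.
Qed.

(** The energy bound degenerates as [e] tends to 0, but only membership in the domain is kept. *)
Lemma dom_sqr_div (e : R) u phi : 0 < e ->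
  dom u -> (forall x, K x -> 0 <= u x) ->
  dom phi -> (forall x, 0 <= phi x <= 1) ->
  dom (fun x => phi x ^+ 2 / (u x + e)).
Proof.
move=> e0 du u0 dphi phi01.
set v := fun x => phi x ^+ 2 / (u x + e).
suff vP : dom v /\ energy v v <=
    8 / e ^+ 2 * energy phi phi + 2 / e ^+ 4 * energy u u by case: vP.
apply: (dom_bounded hcr) => [|n].
  have /subspace_continuousP cu := dom_continuous du.
  have /subspace_continuousP cphi := dom_continuous dphi.
  apply/subspace_continuousP => x Kx.
  have ue : u x + e != 0 by rewrite gt_eqF// ltr_wpDl// u0.
  exact: (cvgM (cvgM (cphi x Kx) (cphi x Kx))
    (cvgV ue (cvgD (cu x Kx) (cvg_cst e)))).
apply: (@le_trans _ _ (8 / e ^+ 2 * En n phi phi + 2 / e ^+ 4 * En n u u)).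
  rewrite !EnE -!(word_sumZ F c r finV0) -(word_sumD F c r finV0).
  apply: (W_le hK finV0 hcr) => x y Kx Ky.
  rewrite -!expr2 (_ : u x - u y = u x + e - (u y + e)); last by ring.
  by apply: sqr_div_lipschitz => //; rewrite lerDr u0.
apply: lerD; rewrite ler_pM2l ?divr_gt0 ?exprn_gt0//;
  exact: (En_le_energy hcr).
Qed.

Lemma cell_harnack (w : seq 'I_N) : cell F K w `&` V0 F K = set0 ->
  exists2 C : R, 0 <= C & forall u, dom u -> (forall x, K x -> 0 <= u x) ->
    L_eq0 F K c r nu u ->
    forall x y, cell F K w x -> cell F K w y -> u x <= C * u y.
Proof.
move=> wV.
have wK : cell F K w `<=` K `\` V0 F K.
  move=> x wx; split; first by case: wx => y Ky <-; exact: Fword_map.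
  by move=> Vx; have : set0 x by rewrite -wV.
have [phi [dphi phi0 phi01 phi1]] := cutoff (cell_compact hF hK (w := w)) wK.
have mK : measurable (K : set (borel X)).
  have [_ cK _] := hK.
  rewrite -[K]setCK; apply: measurableC; apply: sub_sigma_algebra.
  by apply: closed_openC; exact: (compact_closed (@metric_hausdorff _ X)).
have [D D0 osc] := resistance_bounded hF hK finV0 hcr hE.
pose rw := \prod_(i <- w) r i.
have rw0 : 0 < rw by apply: prod_ratio_gt0; exact: (ratio_gt0 hcr).
(* The 4 comes from [sqr_ln_sub_le], [rw] from restricting to the cell, and the last factor bounds
   [energy phi phi - energy u v] for the test function [v]. None of them involves [u] or [e]. *)
pose A := 4 * rw * (energy phi phi + fine (nu K)).
pose C := expR (D * Num.sqrt A).
exists C; first exact: expR_ge0.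
move=> u du u0 Lu.
(* The shift by [e] makes the logarithm available; taking [e / C] for the shift leaves an error of
   at most [e], which is arbitrary. *)
suff main e : 0 < e -> forall x y, cell F K w x -> cell F K w y ->
    u x + e <= C * (u y + e).
  move=> x y wx wy; apply/ler_addgt0Pl => e e0.
  have C0 : 0 < C by exact: expR_gt0.
  have := main (e / C) (divr_gt0 e0 C0) x y wx wy.
  rewrite mulrDr (mulrC C (e / C)) divfK ?gt_eqF// [_ + e]addrC.
  move=> /(le_trans _); apply.
  by rewrite lerDl divr_ge0// ltW.
move=> e0 _ _ [x Kx <-] [y Ky <-].
have ue0 z : K z -> 0 < u z + e by move=> Kz; rewrite ltr_wpDl// u0.
pose v z := phi z ^+ 2 / (u z + e).
have dv : dom v by exact: dom_sqr_div.
(* As [phi] vanishes on [V0], [v] is admissible, and [u * v = phi^2 u / (u + e)] lies between 0 and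
   1. *)
have Euv : - fine (nu K) <= energy u v.
  rewrite Lu//; last by move=> p /phi0 phip; rewrite /v phip expr0n mul0r.
  rewrite lerN2 -[leRHS]mul1r; apply: Rintegral_le_cst => // z Kz.
  have [/andP[phiz0 phiz1] uz] := (phi01 z, u0 z Kz).
  rewrite /v mulr_ge0 ?divr_ge0 ?exprn_ge0 ?(ltW (ue0 z Kz))//=.
  rewrite mulrA ler_pdivrMr ?ue0// mul1r.
  apply: (@le_trans _ _ (u z)); last by rewrite lerDl ltW.
  by rewrite ler_piMr// exprn_ile1.
pose h a b := (phi a * (u b + e) - phi b * (u a + e)) ^+ 2 /
  ((u a + e) * (u b + e)).
have h0 a b : K a -> K b -> 0 <= h a b.
  by move=> /ue0 ? /ue0 ?; rewrite divr_ge0 ?sqr_ge0// ltW// mulr_gt0.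
have hW n : W n h <= En n phi phi - En n u v.
  rewrite -mulN1r !EnE -(word_sumZ F c r finV0) -(word_sumD F c r finV0).
  apply: (W_le hK finV0 hcr) => a b Ka Kb.
  rewrite /h -picone_identity ?ue0// /v.
  by rewrite le_eqVlt; apply/orP; left; apply/eqP; ring.
pose g z := ln (u (Fword F w z) + e).
have [dg Eg] : dom g /\ energy g g <= A.
  apply: (dom_bounded hcr) => [|n].
    have /subspace_continuousP cu := dom_continuous (dom_comp_word w du).
    apply/subspace_continuousP => z Kz.
    have uz := ue0 _ (Fword_map hK w Kz).
    apply: (@cvg_comp _ _ _ (fun t => u (Fword F w t) + e) (@ln R) _
      (nbhs (u (Fword F w z) + e))); last exact: continuous_ln.
    exact: (cvgD (cu z Kz) (cvg_cst e)).
  have cvgE : 4 * rw * (En m phi phi - En m u v) @[m --> \oo] -->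
      4 * rw * (energy phi phi - energy u v).
    apply: (cvgM (cvg_cst _) (cvgB (En_cvg dphi) _)).
    exact: (En_cvg2 finV0 hE).
  apply: (@le_trans _ _ (4 * rw * (energy phi phi - energy u v))); last first.
    by rewrite ler_pM2l ?mulr_gt0// lerD2l lerNl.
  (* [En m u v] need not be monotone in [m], so the fixed level [n] is compared with all large [m]:
     it is raised to [m'] with [size w + m' = m], and then [m] tends to infinity. *)
  apply: (cvgr_to_ge cvgE); near=> m.
  have nm : (size w + n <= m)%N by near: m; exact: nbhs_infty_ge.
  rewrite -(subnKC nm) -addnA; set m' := (n + _)%N.
  apply: (le_trans
    (En_nondecreasing hcr g (leq_addr (m - (size w + n)) n))).
  apply: (@le_trans _ _ (4 * W m' (fun a b => h (Fword F w a) (Fword F w b)))).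
    rewrite EnE -(word_sumZ F c r finV0).
    apply: (W_le hK finV0 hcr) => a b Ka Kb.
    have /ue0 ua := Fword_map hK w Ka; have /ue0 ub := Fword_map hK w Kb.
    rewrite /h !phi1; [|by exists b|by exists a].
    rewrite !mul1r -expr2; apply: le_trans (sqr_ln_sub_le ua ub) _.
    by rewrite -(sqrrN (u _ + e - _)) opprB.
  rewrite -mulrA ler_pM2l//.
  apply: le_trans (W_word hK finV0 hcr m' w h0) _.
  by rewrite ler_pM2l//; exact: hW.
have := osc g dg x y Kx Ky => gxy.
have {}gxy : g x <= g y + D * Num.sqrt A.
  by apply: le_trans gxy _; rewrite lerD2l ler_wpM2l// ler_wsqrtr.
have ux := ue0 _ (Fword_map hK w Kx); have uy := ue0 _ (Fword_map hK w Ky).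
rewrite -[leLHS]lnK ?posrE// -[u (Fword F w y) + e]lnK ?posrE//.
by rewrite /C -expRD ler_expR [D * _ + _]addrC.
Unshelve. all: by end_near. Qed.

End harnack.

(** * From cells to compact sets *)

Section chaining.
Context (R : realType) (X : completeMetricType R) (N : nat)
  (F : 'I_N -> X -> X) (K : set X) (c : X -> X -> R) (r : 'I_N -> R)
  (nu : {finite_measure set (borel X) -> \bar R})
  (hF : forall i, injective_contraction (F i)) (hK : self_similar_set F K)
  (finV0 : finite_set (V0 F K)) (hcr : regular_harmonic_structure F K c r)
  (hE : resistance_form K (dom_energy F K c r) (energy F K c r)).

(** [C] is fixed before [u], and the comparison is two-sided so that it can be reversed and composed
    along chains of points. *)
Definition comparable_on (A : set X) (x : X) (C : R) : Prop :=
  forall u, dom_energy F K c r u -> (forall z, K z -> 0 <= u z) ->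
    L_eq0 F K c r nu u -> forall y, A y -> u y <= C * u x /\ u x <= C * u y.

Lemma comparable_onS (A : set X) (x : X) (C C' : R) : A `<=` K -> K x ->
  C <= C' -> comparable_on A x C -> comparable_on A x C'.
Proof.
move=> AK Kx CC' AC u du u0 Lu y Ay; have [yx xy] := AC u du u0 Lu y Ay.
split; [apply: le_trans yx _|apply: le_trans xy _]; apply: ler_wpM2r => //.
  exact: u0.
exact/u0/AK.
Qed.

(** At a fine enough level the cells containing [x] miss [V0]. The finitely many other cells form a
    closed set avoiding [x], and each point of [K] outside it shares a cell with [x]. *)
Lemma local_harnack (x : X) : (K `\` V0 F K) x ->
  exists2 U : set X, nbhs x U &
    exists2 C : R, 0 <= C & comparable_on (K `&` U) x C.
Proof.
move=> [Kx nVx].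
have V0x : nbhs x (~` V0 F K).
  apply: open_nbhs_nbhs; split=> //; apply: closed_openC.
  apply: (accessible_finite_set_closed.1 _ _ finV0).
  by apply: hausdorff_accessible; exact: metric_hausdorff.
have /nbhs_ballP[e /= e0 xe] := V0x.
have [n small] := cells_small hF hK e0.
have cellC (w : n.-tuple 'I_N) : exists C : R, 0 <= C /\
    (cell F K w x -> forall u, dom_energy F K c r u ->
      (forall z, K z -> 0 <= u z) -> L_eq0 F K c r nu u ->
      forall y z, cell F K w y -> cell F K w z -> u y <= C * u z).
  (* Cells without [x] get the constant 0, so that the sum over all words dominates each constant in
     use. *)
  have [wx|nwx] := pselect (cell F K w x); last by exists 0; split.
  have wV : cell F K w `&` V0 F K = set0.
    rewrite -subset0 => y [wy Vy]; apply: (xe y) => //.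
    by rewrite ballEmdist /=; apply: (small w); rewrite ?size_tuple.
  have [C C0 CP] := cell_harnack nu hF hK finV0 hcr hE wV.
  by exists C; split.
have [C_ C_P] := choice cellC.
pose far := \bigcup_(w in [set w : n.-tuple 'I_N | ~ cell F K w x]) cell F K w.
exists (~` far).
  apply: open_nbhs_nbhs; split; last by move=> [w nwx /nwx].
  apply: closed_openC; apply: closed_bigcup => [|w _].
    exact: finite_finset.
  exact: (cell_closed hF hK (w := w)).
exists (\sum_w C_ w); first by apply: sumr_ge0 => w _; exact: (C_P w).1.
move=> u du u0 Lu y [Ky nfar].
have [w wy _] := cover_cells hK n Ky.
have wx : cell F K w x by apply: contrapT => nwx; apply: nfar; exists w.
have Cw : C_ w <= \sum_w C_ w.
  by rewrite (bigD1 w)//= lerDl sumr_ge0// => w' _; exact: (C_P w').1.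
have harnack := (C_P w).2 wx u du u0 Lu.
split; [apply: le_trans (harnack y x wy wx) _|
        apply: le_trans (harnack x y wx wy) _];
  by apply: ler_wpM2r => //; exact: u0.
Qed.

End chaining.

(** The class of [x] is relatively open in [A], and so is its complement, since a nearby related
    point would bring its whole neighbourhood into the class. *)
Lemma connected_local_equivalence (T : topologicalType) (A : set T)
    (rel : T -> T -> Prop) :
  connected A ->
  (forall x, A x -> rel x x) ->
  (forall x y, rel x y -> rel y x) ->
  (forall x y z, rel x y -> rel y z -> rel x z) ->
  (forall x, A x -> exists2 U, nbhs x U & forall y, A y -> U y -> rel x y) ->
  forall x y, A x -> A y -> rel x y.
Proof.
move=> cA rel_refl rel_sym rel_trans rel_near x y Ax Ay.
suff relA : A `&` [set z | rel x z] = A by have [] : (A `&` [set z | rel x z]) y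
  by rewrite relA.
apply: cA.
- by exists x; split=> //; exact: rel_refl.
- exists [set z | A z -> rel x z]^°; first exact: open_interior.
  apply/seteqP; split=> z [Az].
    move=> /= xz; split=> //; have [U Uz Urel] := rel_near z Az.
    apply: filterS Uz => t Ut At; exact: rel_trans xz (Urel t At Ut).
  by move=> /interior_subset /(_ Az).
- exists (~` [set z | A z -> ~ rel x z]^°).
    by apply: open_closedC; exact: open_interior.
  apply/seteqP; split=> z [Az].
    by move=> xz; split=> // /interior_subset /(_ Az).
  move=> nint; split=> //=; apply: contrapT => nxz; apply: nint.
  have [U Uz Urel] := rel_near z Az.
  apply: filterS Uz => t Ut At xt; apply: nxz.
  exact: rel_trans xt (rel_sym _ _ (Urel t At Ut)).
Qed.

Theorem theorem4 (R : realType) (X : completeMetricType R) (N : nat)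
    (F : 'I_N -> X -> X) (K : set X) (c : X -> X -> R) (r : 'I_N -> R)
    (nu : {finite_measure set (borel X) -> \bar R}) (E : set X)
    (hF : forall i, injective_contraction (F i))
    (hK : self_similar_set F K)
    (hpcf : post_critically_finite F K)
    (hcr : regular_harmonic_structure F K c r)
    (hE : resistance_form K (dom_energy F K c r) (energy F K c r))
    (cE : compact E)
    (EK : E `<=` K `\` V0 F K)
    (Ecomp : forall x, E x -> E `<=` connected_component (K `\` V0 F K) x) :
  exists C : R, forall u : X -> R,
    domM_Laplacian F K c r u ->
    (forall x, K x -> 0 <= u x) ->
    L_eq0 F K c r nu u ->
    sup (u @` E) <= C * inf (u @` E).
Proof.
have [finV0 _] := hpcf.
have [->|/set0P[x0 Ex0]] := eqVneq E set0.
  (* The supremum of the empty set is 0 by convention. *)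
  by exists 0 => u _ _ _; rewrite image_set0 sup0 mul0r.
pose comparable := comparable_on F K c r nu.
(* The constant may depend on the pair of points, but not on [u]; compactness of [E] makes it
   uniform afterwards. *)
pose rel x y := K x /\ K y /\ exists2 C, 0 <= C & comparable [set y] x C.
have rel_component x y : connected_component (K `\` V0 F K) x0 x ->
    connected_component (K `\` V0 F K) x0 y -> rel x y.
  apply: (connected_local_equivalence (@component_connected _ _ _)).
  - move=> z /connected_component_sub[Kz _]; split=> //; split=> //.
    by exists 1 => // u du u0 Lu _ ->; rewrite mul1r.
  - move=> z t [Kz [Kt [C C0 zt]]]; split=> //; split=> //; exists C => //.
    by move=> u du u0 Lu _ ->; have [] := zt u du u0 Lu t erefl.
  - move=> z t s [Kz [Kt [C C0 zt]]] [_ [Ks [C' C'0 ts]]].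
    split=> //; split=> //; exists (C' * C); first exact: mulr_ge0.
    move=> u du u0 Lu _ ->.
    have [tz zt_] := zt u du u0 Lu t erefl.
    have [st ts_] := ts u du u0 Lu s erefl.
    split; first by apply: le_trans st _; rewrite -mulrA ler_wpM2l.
    by apply: le_trans zt_ _; rewrite (mulrC C') -mulrA ler_wpM2l.
  - move=> z /connected_component_sub Kz.
    have [U Uz [C C0 CU]] := local_harnack nu hF hK finV0 hcr hE Kz.
    exists U => // t /connected_component_sub[Kt _] Ut.
    split; first exact: Kz.1.
    split=> //; exists C => // u du u0 Lu _ ->.
    exact: CU.
have Kx0 : K x0 := (EK x0 Ex0).1.
have [C C0 CE] : exists2 C, 0 <= C & comparable E x0 C.
  suff [_ //] : E `<=` K /\ exists2 C, 0 <= C & comparable E x0 C.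
  apply: (compact_local_induction (P := fun S => S `<=` K /\
    exists2 C, 0 <= C & comparable S x0 C)) => //.
  - by split=> //; exists 0.
  - move=> S S' [SK [C C0 CS]] [S'K [C' C'0 C'S]].
    split; first by rewrite subUset.
    exists (C + C'); first exact: addr_ge0.
    have CCS : comparable S x0 (C + C').
      by apply: comparable_onS CS => //; rewrite lerDl.
    have CCS' : comparable S' x0 (C + C').
      by apply: comparable_onS C'S => //; rewrite lerDr.
    by move=> u du u0 Lu y [/(CCS u du u0 Lu)|/(CCS' u du u0 Lu)].
  - move=> S S' SS' [S'K [C C0 CS']]; split; first exact: subset_trans S'K.
    by exists C => // u du u0 Lu y /SS'; exact: CS'.
  move=> x Ex.
  have [U Ux [C C0 CU]] := local_harnack nu hF hK finV0 hcr hE (EK x Ex).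
  exists U => //; split; first by move=> y [/EK[]].
  (* By [Ecomp], [x] and [x0] lie in the same component; the local comparison near [x] is composed
     with the one between [x] and [x0]. *)
  have [_ [Kx [C' C'0 C'x]]] : rel x0 x.
    by apply: rel_component; apply: Ecomp.
  exists (C * C'); first exact: mulr_ge0.
  move=> u du u0 Lu y [Ey Uy].
  have [yx xy] := CU u du u0 Lu y (conj (EK y Ey).1 Uy).
  have [xx0 x0x] := C'x u du u0 Lu x erefl.
  split; first by apply: le_trans yx _; rewrite -mulrA ler_wpM2l.
  by apply: le_trans x0x _; rewrite (mulrC C) -mulrA ler_wpM2l.
(* One factor goes from a point of [E] to [x0], the other from [x0] to a second point; adding 1
   makes division possible. *)
exists ((C + 1) * (C + 1)) => u [_ [du _]] u0 Lu.
have C1 : 0 < (C + 1) * (C + 1) by rewrite mulr_gt0 ?ltr_wpDl.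
have uE : u @` E !=set0 by exists (u x0), x0.
apply: ge_sup => // _ [x Ex <-].
rewrite mulrC -ler_pdivrMr//; apply: lb_le_inf => // _ [y Ey <-].
rewrite ler_pdivrMr// mulrC -mulrA.
have C1C : comparable E x0 (C + 1).
  by apply: comparable_onS CE => //; [move=> z /EK[]|rewrite lerDl].
have [xx0 _] := C1C u du u0 Lu x Ex; have [_ x0y] := C1C u du u0 Lu y Ey.
by apply: le_trans xx0 _; rewrite ler_wpM2l// addr_ge0.
Qed.
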